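(* Let $\mathcal V$ be a congruence modular variety and let $q$ be a $3$-dimensional wobbly cube term for $\mathcal V$. Then $q$ satisfies: (1) $q(x,x,x,x,y,y,y)\approx y$ in $\mathcal V$; (2) $q(x,x,y,y,x,x,y)\approx y$ in $\mathcal V$; (3) for every $\mathbb A\in\mathcal V$ and all $x,y\in A$, $q(x,y,x,y,x,y,x)\equiv_{[\theta,\theta,\theta]}y$, where $\theta=\operatorname{Cg}^{\mathbb A}(\langle x,y\rangle)$ is the congruence of $\mathbb A$ generated by $\langle x,y\rangle$.
   Context: Commutators. Let $2=\{0,1\}$, $k=\{0,\dots,k-1\}$, and let $\mathbb A$ be an algebra with universe $A$. For $k\in\{2,3\}$, $i\in k$ and $a,b\in A$, $\operatorname{cube}_i^k(a,b)\in A^{2^k}$ has value $a$ at $f\in 2^k$ with $f_i=0$ and $b$ at $f$ with $f_i=1$. For $\theta_0,\dots,\theta_{k-1}\in\operatorname{Con}(\mathbb A)$, $M(\theta_0,\dots,\theta_{k-1})$ is the subalgebra of $\mathbb A^{2^k}$ generated by all $\operatorname{cube}_i^k(a,b)$ with $i\in k$, $\langle a,b\rangle\in\theta_i$. For $m\in A^{2^k}$ and $j\in k$, a line of $m$ in direction $j$ is a pair $\langle m_f,m_g\rangle$ with $f,g$ agreeing off $j$, $f_j=0$, $g_j=1$; it is the $(j)$-pivot line if all other coordinates equal $1$, and a $(j)$-supporting line otherwise. $C(\theta_0,\dots,\theta_{k-1};j;\delta)$ means: for all $m\in M(\theta_0,\dots,\theta_{k-1})$, if all $(j)$-supporting lines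 of $m$ are in $\delta$ then the $(j)$-pivot line is in $\delta$. In a congruence modular variety this is known not to depend on $j$; $[\theta_0,\dots,\theta_{k-1}]$ is the least $\delta\in\operatorname{Con}(\mathbb A)$ for which it holds. Difference term. Every congruence modular variety has a difference term, which here (with permuted variables) is a ternary term $d$ such that $d(x,x,y)\approx y$ in $\mathcal V$ and, for all $\mathbb A\in\mathcal V$ and $x,y\in A$, $d(x,y,x)\equiv_{[\theta,\theta]}y$ where $\theta=\operatorname{Cg}^{\mathbb A}(\langle x,y\rangle)$. Wobbly cube term. A $3$-dimensional wobbly cube term is a $7$-ary term of the form $$q(x_1,x_2,x_3,x_4,x_5,x_6,x_7)=d\big(d(x_1,x_2,x_3),\,x_4,\,d(x_5,x_6,x_7)\big)$$ with $d$ a difference term for $\mathcal V$, i.e. a ternary term with $d(x,x,y)\approx y$ in $\mathcal V$ and $d(x,y,x)\equiv_{[\theta,\theta]}y$ for all $\mathbb A\in\mathcal V$ and $x,y\in A$, where $\theta=\operatorname{Cg}^{\mathbb A}(\langle x,y\rangle)$. *)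

(* Defs.v *)
From mathcomp Require Import all_boot.

Set Implicit Arguments.
Unset Strict Implicit.
Unset Printing Implicit Defensive.

Record signature := Signature { symb : Type; arity : symb -> nat }.

Record algebra (S : signature) := Algebra {
  carrier :> Type;
  op : forall o : symb S, ('I_(arity o) -> carrier) -> carrier
}.

Arguments op {S} _ _ _.

Inductive term (S : signature) (X : Type) : Type :=
| Var : X -> term S X
| App : forall o : symb S, ('I_(arity o) -> term S X) -> term S X.

Arguments Var {S X} _.
Arguments App {S X} _ _.

Fixpoint subst (S : signature) (X Y : Type) (s : X -> term S Y)
    (t : term S X) : term S Y :=
  match t with
  | Var x => s x
  | App o ts => App o (fun i => subst s (ts i))
  end.

Fixpoint eval (S : signature) (A : algebra S) (X : Type) (v : X -> A)
    (t : term S X) : A :=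
  match t with
  | Var x => v x
  | App o ts => op A o (fun i => eval v (ts i))
  end.

Arguments eval {S} A {X} v t.

(* A variety is given by a set of identities; since arities are finite,
   countably many variables suffice. *)
Definition variety (S : signature) := term S nat -> term S nat -> Prop.

Definition in_variety (S : signature) (V : variety S) (A : algebra S) : Prop :=
  forall s t, V s t -> forall v : nat -> A, eval A v s = eval A v t.

Record congruence (S : signature) (A : algebra S) := Congruence {
  crel :> A -> A -> Prop;
  con_refl : forall x, crel x x;
  con_sym : forall x y, crel x y -> crel y x;
  con_trans : forall x y z, crel x y -> crel y z -> crel x z;
  con_op : forall (o : symb S) (u v : 'I_(arity o) -> A),
    (forall i, crel (u i) (v i)) -> crel (op A o u) (op A o v)
}.

Section CongruenceLattice.
Variables (S : signature) (A : algebra S).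
Implicit Types alpha beta gamma delta : congruence A.

Definition con_le alpha beta : Prop := forall x y, alpha x y -> beta x y.

Definition con_inf (P : congruence A -> Prop) : congruence A.
Proof.
exists (fun x y => forall delta, P delta -> delta x y).
- by move=> x delta _; apply: con_refl.
- by move=> x y xy delta Pd; apply: con_sym; apply: xy.
- by move=> x y z xy yz delta Pd; apply: (con_trans (xy _ Pd) (yz _ Pd)).
- by move=> o u v uv delta Pd; apply: con_op => i; apply: uv.
Defined.

Definition Cg (R : A -> A -> Prop) : congruence A :=
  con_inf (fun delta => forall x y, R x y -> delta x y).

Definition Cg1 (x y : A) : congruence A := Cg (fun a b => a = x /\ b = y).

Definition con_meet alpha beta : congruence A :=
  con_inf (fun delta => delta = alpha \/ delta = beta).

Definition con_join alpha beta : congruence A :=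
  Cg (fun x y => alpha x y \/ beta x y).

Definition con_modular : Prop :=
  forall alpha beta gamma, con_le alpha gamma ->
  forall x y, con_meet (con_join alpha beta) gamma x y <->
              con_join alpha (con_meet beta gamma) x y.

End CongruenceLattice.

Definition congruence_modular (S : signature) (V : variety S) : Prop :=
  forall A : algebra S, in_variety V A -> con_modular A.

Definition power (S : signature) (A : algebra S) (I : Type) : algebra S :=
  @Algebra S (I -> A) (fun o u i => op A o (fun l => u l i)).

Inductive Sg (S : signature) (A : algebra S) (G : A -> Prop) : A -> Prop :=
| Sg_gen : forall x, G x -> Sg G x
| Sg_op : forall (o : symb S) (u : 'I_(arity o) -> A),
    (forall l, Sg G (u l)) -> Sg G (op A o u).

Section Commutator.
Variables (S : signature) (A : algebra S) (k : nat).

(* 2^k, with false for 0 and true for 1 *)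
Definition vertex := {ffun 'I_k -> bool}.

Definition cube (i : 'I_k) (a b : A) : power A vertex :=
  fun f => if f i then b else a.

Definition M (theta : 'I_k -> congruence A) : power A vertex -> Prop :=
  Sg (fun m : power A vertex =>
        exists (i : 'I_k) (a b : A), theta i a b /\ m = cube i a b).

Definition is_line (j : 'I_k) (f g : vertex) : Prop :=
  [/\ f j = false, g j = true & forall i, i != j -> f i = g i].

Definition is_pivot (j : 'I_k) (f : vertex) : Prop :=
  forall i, i != j -> f i = true.

Definition centralizes (theta : 'I_k -> congruence A) (j : 'I_k)
    (delta : congruence A) : Prop :=
  forall m, M theta m ->
    (forall f g, is_line j f g -> ~ is_pivot j f -> delta (m f) (m g)) ->
    forall f g, is_line j f g -> is_pivot j f -> delta (m f) (m g).

(* The direction j is kept as a parameter: independence of j is a theorem about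
   congruence modular varieties, not part of the definition. *)
Definition commutator (j : 'I_k) (theta : 'I_k -> congruence A) :
    congruence A :=
  con_inf (centralizes theta j).

Lemma commutator_centralizes j theta :
  centralizes theta j (commutator j theta).
Proof.
move=> m Mm supp f g line piv delta Cdelta.
by apply: (Cdelta m Mm) => // f' g' line' npiv'; apply: supp.
Qed.

Lemma commutator_least j theta delta :
  centralizes theta j delta -> con_le (commutator j theta) delta.
Proof. by move=> Cdelta x y; apply. Qed.

End Commutator.

Definition difference_term (S : signature) (V : variety S) (j : 'I_2)
    (d : term S 'I_3) : Prop :=
  forall A : algebra S, in_variety V A -> forall x y : A,
    eval A (tnth [tuple x; x; y]) d = y /\
    commutator j (fun _ : 'I_2 => Cg1 x y)
      (eval A (tnth [tuple x; y; x]) d) y.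

Definition ternary_app (S : signature) (X : Type) (d : term S 'I_3)
    (t1 t2 t3 : term S X) : term S X :=
  subst (tnth [tuple t1; t2; t3]) d.

Definition cube_term_of (S : signature) (d : term S 'I_3) : term S 'I_7 :=
  let x (i : 'I_7) := Var i in
  ternary_app d
    (ternary_app d (x (@Ordinal 7 0 isT)) (x (@Ordinal 7 1 isT))
                   (x (@Ordinal 7 2 isT)))
    (x (@Ordinal 7 3 isT))
    (ternary_app d (x (@Ordinal 7 4 isT)) (x (@Ordinal 7 5 isT))
                   (x (@Ordinal 7 6 isT))).

Definition wobbly_cube_term (S : signature) (V : variety S) (j : 'I_2)
    (q : term S 'I_7) : Prop :=
  exists2 d : term S 'I_3, difference_term V j d & q = cube_term_of d.

(* Main.v *)
Require Import Defs.
From mathcomp Require Import all_boot.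
From Stdlib Require Import FunctionalExtensionality ProofIrrelevance.

(** With [u = d(x,y,x)], the value in (3) is [d(u,y,u)], which is congruent to
    [y] modulo [[psi,psi]], [psi = Cg(u,y) <= [theta,theta]].  So it suffices
    that every [delta] satisfying [C(theta,theta,theta;delta)] also satisfies
    [C(psi,psi;delta)].
    Let [E] be [theta], seen as a subalgebra of [A^2], let [eps] be the set of
    elements of [E] lying in [delta], and let [kappa] be the largest congruence
    of [E] saturating [eps].  Its restriction [rho] to the diagonal satisfies
    [C(rho,theta;delta)] by construction, so only [[theta,theta] <= rho] is
    left.  This follows from the modular law in the algebra of cubes
    [M(theta,theta,theta)], seen as squares of elements of [E]: as in the proof
    of the shifting lemma, it turns a square [p r; q s] with [p kappa q] into a
    chain, from the constant square [r] to [r r; s s], of squares [r r; v u]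
    in which [v \in eps] iff [u \in eps] whenever [r \in eps]. *)

Set Implicit Arguments.
Unset Strict Implicit.
Unset Printing Implicit Defensive.

(** * Terms, powers and subalgebras *)

Lemma eval_subst (S : signature) (A : algebra S) (X Y : Type)
    (s : X -> term S Y) (v : Y -> A) (t : term S X) :
  eval A v (subst s t) = eval A (fun x => eval A v (s x)) t.
Proof.
elim: t => [//|o ts IH] /=; congr (op A o _).
by apply: functional_extensionality => i; apply: IH.
Qed.

Lemma con_eval (S : signature) (A : algebra S) (theta : congruence A)
    (X : Type) (v w : X -> A) (t : term S X) :
  (forall x, theta (v x) (w x)) -> theta (eval A v t) (eval A w t).
Proof.
by move=> vw; elim: t => [x|o ts IH] /=; [apply: vw | apply: con_op].
Qed.

Lemma Cg1_gen (S : signature) (A : algebra S) (x y : A) : Cg1 x y x y.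
Proof. by move=> delta; apply. Qed.

Lemma Cg1_le (S : signature) (A : algebra S) (delta : congruence A) (x y : A) :
  delta x y -> con_le (Cg1 x y) delta.
Proof. by move=> xy a b; apply=> _ _ [-> ->]. Qed.

Lemma eval_power (S : signature) (A : algebra S) (I X : Type)
    (v : X -> power A I) (t : term S X) (i : I) :
  eval (power A I) v t i = eval A (fun x => v x i) t.
Proof.
elim: t => [//|o ts IH] /=; congr (op A o _).
by apply: functional_extensionality => l; apply: IH.
Qed.

Lemma in_variety_power (S : signature) (V : variety S) (A : algebra S)
    (I : Type) : in_variety V A -> in_variety V (power A I).
Proof.
move=> VA s t st v; apply: functional_extensionality => i.
by rewrite !eval_power; apply: VA.
Qed.

Section Subalgebra.
Variables (S : signature) (A : algebra S) (P : A -> Prop).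
Hypothesis P_op : forall (o : symb S) (u : 'I_(arity o) -> A),
  (forall i, P (u i)) -> P (op A o u).

Definition subalgebra : algebra S :=
  @Algebra S {x : A | P x}
    (fun o u => exist P (op A o (fun i => sval (u i)))
                        (P_op (fun i => proj2_sig (u i)))).

Lemma subalgebra_inj (x y : subalgebra) : sval x = sval y -> x = y.
Proof.
by case: x y => [x Px] [y Py] /= xy; subst y; rewrite (proof_irrelevance _ Px Py).
Qed.

Lemma eval_subalgebra (X : Type) (v : X -> subalgebra) (t : term S X) :
  sval (eval subalgebra v t) = eval A (fun x => sval (v x)) t.
Proof.
elim: t => [//|o ts IH] /=; congr (op A o _).
by apply: functional_extensionality => i; apply: IH.
Qed.

Lemma in_variety_subalgebra (V : variety S) :
  in_variety V A -> in_variety V subalgebra.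
Proof.
move=> VA s t st v; apply: subalgebra_inj.
by rewrite !eval_subalgebra; apply: VA.
Qed.

End Subalgebra.

(** * The largest congruence saturating a set *)

Section Syntactic.
Variables (S : signature) (A : algebra S).

Definition unary_polynomial : power A A -> Prop :=
  Sg (fun f : power A A => f = id \/ exists a : A, f = fun=> a).

Definition saturates (theta : congruence A) (P : A -> Prop) : Prop :=
  forall x y, theta x y -> P x -> P y.

Lemma unary_polynomial_comp (f g : A -> A) :
  unary_polynomial f -> unary_polynomial g -> unary_polynomial (f \o g).
Proof.
move=> Ff Fg; elim: Ff => [h [->|[a ->]]|o u _ IH] //.
- by apply: Sg_gen; right; exists a.
- exact: (@Sg_op S (power A A) _ o (fun l => u l \o g)).
Qed.

Lemma con_unary_polynomial (theta : congruence A) (f : A -> A) (x y : A) :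
  unary_polynomial f -> theta x y -> theta (f x) (f y).
Proof.
move=> Ff xy; elim: Ff => [h [->|[a ->]]|o u _ IH] //; first exact: con_refl.
exact: con_op.
Qed.

Variable P : A -> Prop.

(** The analogue of the syntactic congruence of a formal language, with unary polynomials as
    contexts. *)
Definition syntactic_rel (x y : A) : Prop :=
  forall f, unary_polynomial f -> P (f x) <-> P (f y).

(** Arguments are exchanged one at a time; with a single argument left free, [op A o] is a unary
    polynomial. *)
Lemma syntactic_rel_op (o : symb S) (u v : 'I_(arity o) -> A) :
  (forall i, syntactic_rel (u i) (v i)) ->
  syntactic_rel (op A o u) (op A o v).
Proof.
move=> uv f Ff.
pose w n (i : 'I_(arity o)) := if i < n then v i else u i.
have wP n : P (f (op A o u)) <-> P (f (op A o (w n))).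
  elim: n => [|n IH].
    by have -> : w 0 = u by apply: functional_extensionality.
  apply: (iff_trans IH); case: (ltnP n (arity o)) => [lt_n|le_n]; last first.
    have -> : w n.+1 = w n; last by [].
    apply: functional_extensionality => i; rewrite /w.
    by rewrite (leq_trans (ltn_ord i) le_n) (leq_trans (ltn_ord i) (leqW le_n)).
  pose i0 := Ordinal lt_n.
  pose g (x : A) := op A o (fun i => if i == i0 then x else w n i).
  have gw : op A o (w n) = g (u i0).
    congr (op A o _); apply: functional_extensionality => i.
    by case: eqP => // ->; rewrite /w ltnn.
  have gw1 : op A o (w n.+1) = g (v i0).
    congr (op A o _); apply: functional_extensionality => i.
    rewrite /w ltnS leq_eqVlt -(inj_eq val_inj i i0) /=.
    by case: eqP => //= i_n; have -> : i = i0 by apply: val_inj.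
  rewrite gw gw1; apply: (uv i0 (f \o g)); apply: unary_polynomial_comp => //.
  apply: (@Sg_op S (power A A) _ o
            (fun i x => if i == i0 then x else w n i)) => i.
  by apply: Sg_gen; case: eqP => _; [left | right; exists (w n i)].
apply: (iff_trans (wP (arity o))).
have -> // : w (arity o) = v.
by apply: functional_extensionality => i; rewrite /w ltn_ord.
Qed.

Definition syntactic_con : congruence A.
Proof.
exists syntactic_rel.
- by [].
- by move=> x y xy f Ff; apply: iff_sym; apply: xy.
- by move=> x y z xy yz f Ff; apply: (iff_trans (xy f Ff)); apply: yz.
- exact: syntactic_rel_op.
Defined.

Lemma syntactic_saturates : saturates syntactic_con P.
Proof. by move=> x y xy; apply: (xy id _).1; apply: Sg_gen; left. Qed.

Lemma syntactic_largest (theta : congruence A) :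
  saturates theta P -> con_le theta syntactic_con.
Proof.
move=> sat x y xy f Ff; split; apply: sat; apply: con_unary_polynomial => //.
exact: con_sym.
Qed.

End Syntactic.

(** Both congruences lie below the largest one saturating [P], hence so does their join. *)
Lemma con_join_saturates (S : signature) (A : algebra S)
    (alpha beta : congruence A) (P : A -> Prop) :
  saturates alpha P -> saturates beta P -> saturates (con_join alpha beta) P.
Proof.
move=> sata satb x y xy; apply: (@syntactic_saturates S A P).
by apply: xy => a b [] ab; apply: syntactic_largest ab.
Qed.

Definition con_preim (S : signature) (A B : algebra S) (h : A -> B)
    (hM : forall o u, h (op A o u) = op B o (h \o u)) (theta : congruence B) :
  congruence A.
Proof.
exists (fun x y => theta (h x) (h y)).
- by move=> x; apply: con_refl.
- by move=> x y; apply: con_sym.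
- by move=> x y z; apply: con_trans.
- by move=> o u v uv; rewrite !hM; apply: con_op.
Defined.

Definition con_eq (S : signature) (A : algebra S) : congruence A.
Proof.
exists eq => // [x y z -> //|o u v uv].
by congr (op A o _); apply: functional_extensionality.
Defined.

(** * Cubes as squares of pairs *)

Section Squares.
Variables (S : signature) (A : algebra S) (theta delta : congruence A).

Lemma pair_op (o : symb S) (u : 'I_(arity o) -> power A bool) :
  (forall i, theta (u i false) (u i true)) ->
  theta (op (power A bool) o u false) (op (power A bool) o u true).
Proof. exact: con_op. Qed.

Definition con_alg : algebra S :=
  @subalgebra S (power A bool) (fun e => theta (e false) (e true)) pair_op.

Definition diag (a : A) : con_alg :=
  exist (fun e : power A bool => theta (e false) (e true)) (fun=> a)
    (con_refl theta a).

Lemma diag_op (o : symb S) (u : 'I_(arity o) -> A) :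
  diag (op A o u) = op con_alg o (diag \o u).
Proof. exact: subalgebra_inj. Qed.

Definition eps (e : con_alg) : Prop := delta (sval e false) (sval e true).

Definition kappa : congruence con_alg := syntactic_con eps.

Definition rho : congruence A := con_preim diag_op kappa.

(** The first index selects the row: [p r; q s] has r at [(false, true)] and q at
    [(true, false)]. *)
Definition square : algebra S := power con_alg (bool * bool).

(** These are the cube generators; the third direction runs inside the entries and so yields the
    constant squares. *)
Definition square_gen (m : square) : Prop :=
  (exists a b, theta a b /\ m = fun z => diag (if z.1 then b else a)) \/
  (exists a b, theta a b /\ m = fun z => diag (if z.2 then b else a)) \/
  exists e, m = fun=> e.

Definition squares : square -> Prop := Sg square_gen.

Lemma con_ite (a b : A) (c c' : bool) :
  theta a b -> theta (if c then b else a) (if c' then b else a).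
Proof.
by case: c c' => [] [] ab; first [exact: con_refl | exact: con_sym | exact: ab].
Qed.

(** Reindexing sends generators to generators. It serves to reflect squares and to repeat a row or a
    column. *)
Lemma squares_reindex (g h : bool -> bool) (m : square) :
  squares m -> squares (fun z => m (g z.1, h z.2)).
Proof.
elim=> {}m.
  move=> [[a [b [ab ->]]]|[[a [b [ab ->]]]|[e ->]]]; apply: Sg_gen.
  - left; exists (if g false then b else a), (if g true then b else a).
    split; first exact: con_ite.
    by apply: functional_extensionality => -[[] c].
  - right; left; exists (if h false then b else a), (if h true then b else a).
    split; first exact: con_ite.
    by apply: functional_extensionality => -[c []].
  - by right; right; exists e.
move=> u _ IH.
exact: (@Sg_op S square _ m (fun l z => u l (g z.1, h z.2))).
Qed.

(** The constants of a polynomial become constant squares, which are generators. *)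
Lemma squares_polynomial (f : con_alg -> con_alg) (m : square) :
  unary_polynomial f -> squares m -> squares (f \o m).
Proof.
move=> Ff Qm; elim: Ff => [h [->|[e ->]]|o u _ IH] //.
- by apply: Sg_gen; right; right; exists e.
- exact: (@Sg_op S square _ o (fun l => u l \o m)).
Qed.

(** * The shifting argument in the algebra of squares *)

Section Modular.

Variables (j3 : 'I_3)
  (delta_cent : centralizes (fun=> theta) j3 delta).

Lemma squares_cube (m : square) : squares m ->
  M (fun _ : 'I_3 => theta) (fun f : vertex 3 =>
    sval (m (f (lift j3 ord0), f (lift j3 ord_max))) (f j3)).
Proof.
elim=> {}m.
  move=> [[a [b [ab ->]]]|[[a [b [ab ->]]]|[e ->]]]; apply: Sg_gen.
  - by exists (lift j3 ord0), a, b.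
  - by exists (lift j3 ord_max), a, b.
  - exists j3, (sval e false), (sval e true); split; first exact: (proj2_sig e).
    by apply: functional_extensionality => f /=; rewrite /cube; case: (f j3).
move=> u _ IH.
exact: (@Sg_op S (power A (vertex 3)) _ m (fun l (f : vertex 3) =>
    sval (u l (f (lift j3 ord0), f (lift j3 ord_max))) (f j3))).
Qed.

(** In the cube of [m] the lines in direction [j3] are the four entries, and the entry at
    [(true, true)] is the pivot line. *)
Lemma eps_square (m : square) : squares m ->
  eps (m (false, false)) -> eps (m (false, true)) -> eps (m (true, false)) ->
  eps (m (true, true)).
Proof.
move=> /squares_cube/delta_cent C e00 e01 e10.
pose f b : vertex 3 := [ffun i => (i != j3) || b].
have fl b i : f b (lift j3 i) = true by rewrite ffunE eq_sym neq_lift.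
have fj b : f b j3 = b by rewrite ffunE eqxx.
have:= C _ (f false) (f true); rewrite !fl !fj; apply.
- move=> g h [gj hj gh] npiv; rewrite gj hj -!gh ?(eq_sym _ j3) ?neq_lift //.
  case g0: (g (lift j3 ord0)); case g1: (g (lift j3 ord_max)) => //.
  (* Both coordinates off [j3] are now [true], so the line would be the pivot. *)
  case: npiv => i; case: (unliftP j3 i) => [k ->|->]; last by rewrite eqxx.
  move=> _; have [->|->] : k = ord0 \/ k = ord_max; last by [].
    by case: k => [[|[|//]] lt_k]; [left | right]; apply: val_inj.
  by [].
- by split=> // i /negPf ij; rewrite !ffunE ij.
- by move=> i /negPf ij; rewrite ffunE ij.
Qed.

Lemma squares_op (o : symb S) (u : 'I_(arity o) -> square) :
  (forall l, squares (u l)) -> squares (op square o u).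
Proof. exact: Sg_op. Qed.

Let Q : algebra S := subalgebra squares_op.

Definition at_pos (lambda : congruence con_alg) (z : bool * bool) :
    congruence Q :=
  @con_preim S Q con_alg (fun m => sval m z) (fun _ _ => erefl) lambda.

Hypothesis modQ : con_modular Q.

Lemma shift_squares (m : square) : squares m ->
  kappa (m (false, false)) (m (true, false)) ->
  eps (m (false, true)) -> eps (m (true, true)).
Proof.
move=> Qm pq er.
pose sq g h : Q := exist squares _ (squares_reindex g h Qm).
(* In matrix form: [X] = [r r; r r], [Y] = [p r; p r], [Z] = [p r; q s], [W] = [r r; s s]. *)
pose X := sq (fun=> false) (fun=> true).
pose Y := sq (fun=> false) id.
pose Z := sq id id.
pose W := sq id (fun=> true).
(* [X alpha Y gamma Z alpha W] and [X beta W] with [gamma <= beta], so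
   modularity links [X] to [W] by [gamma] and [alpha /\ beta]; both preserve
   the predicate [T] below. *)
pose beta := con_meet (at_pos (con_eq con_alg) (false, false))
                      (at_pos (con_eq con_alg) (false, true)).
pose alpha := at_pos (con_eq con_alg) (true, true).
pose gamma := con_meet beta (at_pos kappa (true, false)).
have betaE (x y : Q) : beta x y <->
    sval x (false, false) = sval y (false, false) /\
    sval x (false, true) = sval y (false, true).
  split=> [xy|[xy1 xy2] _ [->|->] //].
  by split; [apply: (xy (at_pos (con_eq _) (false, false))); left
            |apply: (xy (at_pos (con_eq _) (false, true))); right].
pose T (x : Q) := [/\ eps (sval x (false, false)), eps (sval x (false, true))
                   & eps (sval x (true, false))].
have satg : saturates gamma T.
  move=> x y xy [ec ee ev].
  have [xyc xye] : sval x (false, false) = sval y (false, false) /\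
      sval x (false, true) = sval y (false, true).
    by apply/betaE; apply: (xy beta); left.
  rewrite /T -xyc -xye; split=> //; apply: syntactic_saturates ev.
  by apply: (xy (at_pos kappa (true, false))); right.
have sata : saturates (con_meet alpha beta) T.
  move=> x y xy [ec ee ev].
  have xyu : sval x (true, true) = sval y (true, true).
    by apply: (xy alpha); left.
  have [xyc xye] : sval x (false, false) = sval y (false, false) /\
      sval x (false, true) = sval y (false, true).
    by apply/betaE; apply: (xy beta); right.
  (* Membership in [eps] passes to the entry at [(true, true)], which [x] and [y] share, and then
     back along the row in [y] with its columns swapped. *)
  have eu := eps_square (proj2_sig x) ec ee ev.
  rewrite /T -xyc -xye; split=> //.
  apply: (eps_square (squares_reindex id negb (proj2_sig y))) => /=.
  - by rewrite -xye.
  - by rewrite -xyc.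
  - by rewrite -xyu.
have gamma_beta : con_le gamma beta by move=> x y xy; apply: (xy beta); left.
have XW : con_join gamma (con_meet alpha beta) X W.
  apply: (modQ alpha gamma_beta X W).1 => _ [->|->]; last by apply/betaE.
  apply: (@con_trans _ _ _ _ Y).
    by move=> lambda; apply; right.
  apply: (@con_trans _ _ _ _ Z).
    move=> lambda; apply; left => _ [->|->]; first exact/betaE.
    exact: pq.
  by move=> lambda; apply; right.
by have [] := con_join_saturates satg sata XW (And3 er er er).
Qed.

(** A unary polynomial is applied to the whole square before shifting; swapping the rows gives the
    converse implication. *)
Lemma kappa_squares (m : square) : squares m ->
  kappa (m (false, false)) (m (true, false)) ->
  kappa (m (false, true)) (m (true, true)).
Proof.
move=> Qm pq f Ff.
have Qf := squares_polynomial Ff Qm.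
have fpq := con_unary_polynomial Ff pq.
split; first exact: (shift_squares Qf fpq).
exact: (shift_squares (squares_reindex negb id Qf) (con_sym fpq)).
Qed.

Definition vertex2 (j : 'I_2) (z : bool * bool) : vertex 2 :=
  [ffun i => if i == j then z.1 else z.2].

Lemma vertex2E (j : 'I_2) (f : vertex 2) :
  f = vertex2 j (f j, f (lift j ord0)).
Proof.
apply/ffunP => i; rewrite ffunE /=; case: (unliftP j i) => [k ->|->].
  by rewrite [k]ord1 eq_sym (negPf (neq_lift _ _)).
by rewrite eqxx.
Qed.

Lemma squares_diag (j : 'I_2) (m : power A (vertex 2)) :
  M (fun=> theta) m -> squares (fun z => diag (m (vertex2 j z))).
Proof.
elim=> {}m.
  move=> [i [a [b [ab ->]]]]; apply: Sg_gen.
  case: (eqVneq i j) => [->|/negPf ij].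
  - left; exists a, b; split=> //; apply: functional_extensionality => z.
    by rewrite /cube ffunE eqxx.
  - right; left; exists a, b; split=> //; apply: functional_extensionality => z.
    by rewrite /cube ffunE ij.
move=> u _ IH.
have -> : (fun z => diag (op (power A (vertex 2)) m u (vertex2 j z))) =
    op square m (fun l z => diag (u l (vertex2 j z))).
  by apply: functional_extensionality => z; apply: diag_op.
exact: squares_op.
Qed.

(** In a square of diagonal entries the left column is the supporting line and the right column the
    pivot line, so [kappa_squares] applies. *)
Lemma rho_centralizes (j : 'I_2) : centralizes (fun=> theta) j rho.
Proof.
move=> m Mm supp f g [fj gj fg] piv.
have ne : lift j ord0 != j by rewrite eq_sym neq_lift.
have fl : f (lift j ord0) = true by apply: piv.
rewrite (vertex2E j f) (vertex2E j g) fj gj -fg // fl.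
apply: (kappa_squares (squares_diag j Mm)); apply: supp.
  split=> [||i /negPf ij]; by rewrite !ffunE ?eqxx ?ij.
by move=> /(_ _ ne); rewrite ffunE (negPf ne).
Qed.

Lemma commutator2_le_rho (j : 'I_2) :
  con_le (commutator j (fun=> theta)) rho.
Proof. exact: (commutator_least (@rho_centralizes j)). Qed.

End Modular.

(** * From a congruence below [rho] to the binary centralizer condition *)

Section CentralizesRho.
Variables (j : 'I_2) (psi : congruence A).
Hypotheses (psi_theta : con_le psi theta) (psi_rho : con_le psi rho).

Lemma con_line (m : power A (vertex 2)) (a : bool) : M (fun=> psi) m ->
  theta (m (vertex2 j (false, a))) (m (vertex2 j (true, a))).
Proof.
elim=> {}m; last by move=> u _ IH; apply: con_op.
move=> [i [x [y [/psi_theta xy ->]]]]; rewrite /cube !ffunE /=.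
by case: (i == j) => //=; apply: con_refl.
Qed.

(** A generator in direction [j] repeats one line; one in the other direction has diagonal lines,
    related by [psi_rho]. Quantifying over [e] keeps the proofs that lines lie in [theta] out of the
    induction. *)
Lemma kappa_lines (m : power A (vertex 2)) : M (fun=> psi) m ->
  forall e : bool -> con_alg,
  (forall a b, sval (e a) b = m (vertex2 j (b, a))) ->
  kappa (e false) (e true).
Proof.
elim=> {}m.
  move=> [i [x [y [xy ->]]]] e; rewrite /cube.
  case: (eqVneq i j) => [->|/negPf ij] em.
    have -> : e false = e true; last exact: con_refl.
    apply: subalgebra_inj; apply: functional_extensionality => b.
    by rewrite !em !ffunE eqxx.
  have eE a : e a = diag (if a then y else x).
    apply: subalgebra_inj; apply: functional_extensionality => b.
    by rewrite em ffunE ij.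
  by rewrite !eE; apply: psi_rho.
move=> u Mu IH e em.
pose eu a l : con_alg :=
  exist (fun e : power A bool => theta (e false) (e true))
    (fun b => u l (vertex2 j (b, a)))
    (con_line a (Mu l)).
have eE a : e a = op con_alg m (eu a).
  by apply: subalgebra_inj; apply: functional_extensionality => b; rewrite em.
by rewrite !eE; apply: con_op => l; apply: (IH l (eu^~ l)).
Qed.

(** The supporting and the pivot line are [kappa]-related elements of [con_alg], and [kappa]
    saturates [eps]. *)
Lemma centralizes_rho : centralizes (fun=> psi) j delta.
Proof.
move=> m Mm supp f g [fj gj fg] piv.
have ne : lift j ord0 != j by rewrite eq_sym neq_lift.
have fl : f (lift j ord0) = true by apply: piv.
pose e a : con_alg :=
  exist (fun e : power A bool => theta (e false) (e true))
    (fun b => m (vertex2 j (b, a))) (con_line a Mm).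
rewrite (vertex2E j f) (vertex2E j g) fj gj -fg // fl.
have /syntactic_saturates : kappa (e false) (e true) by exact: (kappa_lines Mm).
apply; apply: supp; first by split=> [||i /negPf ij]; rewrite !ffunE ?eqxx ?ij.
by move=> /(_ _ ne); rewrite ffunE (negPf ne).
Qed.

End CentralizesRho.

End Squares.

(** * Evaluation of the cube term and the three properties *)

Lemma eval_ternary_app (S : signature) (A : algebra S) (X : Type) (v : X -> A)
    (d : term S 'I_3) (t1 t2 t3 : term S X) :
  eval A v (ternary_app d t1 t2 t3) =
  eval A (tnth [tuple eval A v t1; eval A v t2; eval A v t3]) d.
Proof.
rewrite /ternary_app eval_subst; congr (eval A _ d).
by apply: functional_extensionality => -[[|[|[|]]] lt3].
Qed.

Lemma eval_cube_term (S : signature) (A : algebra S) (d : term S 'I_3)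
    (x1 x2 x3 x4 x5 x6 x7 : A) :
  let D a b c := eval A (tnth [tuple a; b; c]) d in
  eval A (tnth [tuple x1; x2; x3; x4; x5; x6; x7]) (cube_term_of d) =
  D (D x1 x2 x3) x4 (D x5 x6 x7).
Proof. by rewrite /cube_term_of !eval_ternary_app. Qed.

Theorem proposition9p3 (S : signature) (V : variety S)
    (hV : congruence_modular V) (j2 : 'I_2) (j3 : 'I_3)
    (q : term S 'I_7) (hq : wobbly_cube_term V j2 q) :
  (forall A : algebra S, in_variety V A -> forall x y : A,
     eval A (tnth [tuple x; x; x; x; y; y; y]) q = y) /\
  (forall A : algebra S, in_variety V A -> forall x y : A,
     eval A (tnth [tuple x; x; y; y; x; x; y]) q = y) /\
  (forall A : algebra S, in_variety V A -> forall x y : A,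
     commutator j3 (fun _ : 'I_3 => Cg1 x y)
       (eval A (tnth [tuple x; y; x; y; x; y; x]) q) y).
Proof.
case: hq => d hd ->; split; [|split] => A VA x y; rewrite eval_cube_term.
- by rewrite (hd A VA x x).1 (hd A VA y y).1 (hd A VA x y).1.
- by rewrite (hd A VA x y).1 (hd A VA y y).1.
move=> delta delta_cent; set u := eval A (tnth [tuple x; y; x]) d.
set theta := Cg1 x y in delta_cent.
(* The algebra of squares arises from [A] by powers and subalgebras, so it lies in the variety. *)
have modQ : con_modular (subalgebra (@squares_op S A theta)).
  apply: hV; apply: in_variety_subalgebra; apply: in_variety_power.
  exact/in_variety_subalgebra/in_variety_power.
have u_theta : theta u y.
  (* Writing [y] as d(y,y,y) allows comparison with [u] = d(x,y,x) argument by argument. *)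
  rewrite -[X in theta _ X](hd A VA y y).1.
  apply: con_eval => -[[|[|[|//]]] lt3].
  - exact: Cg1_gen.
  - exact: (con_refl theta y).
  - exact: Cg1_gen.
have u_rho : rho theta delta u y.
  by apply: (commutator2_le_rho delta_cent modQ); apply: (hd A VA x y).2.
(* What remains is the difference term property for the pair [u], [y]. *)
apply: (commutator_least (centralizes_rho (Cg1_le u_theta) (Cg1_le u_rho))).
exact: (hd A VA u y).2.
Qed.
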